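(* Let $k$ be a perfect field of characteristic $p$, $p$ an odd prime, and $d\ge1$ an integer not divisible by $p$. There is a non-empty Zariski open subset $U\subseteq A$ such that for every $a\in U(k)$, with $Y=Y_a$: (1) if $1<J\le(p+1)/2$, then $\Phi_J$ is surjective; (2) if $(p+1)/2\le J<p$, then $\Phi_J$ is injective.
   Context: $A\subseteq\mathbb{A}^{d+1}_k$ is the open set of tuples $(a_0,\dots,a_d)$ with $a_d\ne0$; for $a\in A(k)$, $f_a(x)=\sum_{i=0}^d a_ix^i$ and $Y_a$ is the smooth projective curve with function field $k(x,y)$, $y^p-y=f_a(x)$. $\mathcal{C}$ is the Cartier operator on $H^0(Y,\Omega^1_Y)$: writing $\omega=(f_0+f_1x+\cdots+f_{p-1}x^{p-1})\,dx$ with $f_i\in k(Y)^p$, $\mathcal{C}(\omega)=f_{p-1}^{1/p}\,dx$. For $0<j<p$ and integers $0<i<(p-j)d/p$ put $\omega_{i,j}=y^{j-1}x^{i-1}\,dx$. For $0<J<p$, ${}'H^J$ is the $k$-span of the $\omega_{i,J}$ with $0<i<(p-J)d/p$ and $p\nmid i$. For $0<\ell<p$ and $\ell\le e<p$, $H(\ell,e)$ is the $k$-span of $\omega_{i,\ell}$ with $0<i\le\left\lfloor\frac{(p(e+1-\ell)-e)d}{p^2}\right\rfloor$ (so $H(\ell,e-1)\subseteq H(\ell,e)$ for $\ell<e$). It is a fact that $\mathcal{C}({}'H^J)\subseteq\bigoplus_{\ell=1}^{J-1}H(\ell,J)$. For $1<J<p$, $\Phi_J$ is the composite \[{}'H^J\xrightarrow{\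 \mathcal{C}\ }\bigoplus_{\ell=1}^{J-1}H(\ell,J)\longrightarrow\bigoplus_{\ell=1}^{J-1}\frac{H(\ell,J)}{H(\ell,J-1)}\] with the natural projection. *)

(* Defs.v *)
From HB Require Import structures.
From mathcomp Require Import all_boot all_algebra.
From mathcomp Require Import boolp classical_sets functions.
From mathcomp.multinomials Require Import mpoly.

Set Implicit Arguments.
Unset Strict Implicit.
Unset Printing Implicit Defensive.

Import GRing.Theory.
Local Open Scope classical_set_scope.
Local Open Scope ring_scope.

Definition perfect_field (k : fieldType) : Prop :=
  forall q : nat, q \in [pchar k] -> forall c : k, exists b : k, b ^+ q = c.

(* An open subscheme of affine n-space over k is presented by a set S of
   polynomials, as the union of the basic open sets D(g), g \in S; it is handled
   through its functor of points.  Inclusion and non-emptiness are scheme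
   theoretic, i.e., tested over all field extensions L of k: when k is finite, a
   non-empty open subscheme need not have a k-rational point. *)
Definition zariski_open (k : fieldType) (n : nat) : Type := set {mpoly k[n]}.

Definition open_points (k : fieldType) (n : nat) (S : zariski_open k n)
    (L : fieldType) (iota : {rmorphism k -> L}) : set ('I_n -> L) :=
  [set v | exists2 g, S g & mmap iota v g != 0].

Definition open_rational_points (k : fieldType) (n : nat)
    (S : zariski_open k n) : set ('I_n -> k) :=
  [set v | exists2 g, S g & g.@[v] != 0].

Definition open_nonempty (k : fieldType) (n : nat) (S : zariski_open k n) :=
  exists (L : fieldType) (iota : {rmorphism k -> L}), open_points S iota !=set0.

Definition open_sub (k : fieldType) (n : nat) (S T : zariski_open k n) :=
  forall (L : fieldType) (iota : {rmorphism k -> L}),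
    open_points S iota `<=` open_points T iota.

Definition param_space (k : fieldType) (d : nat) : zariski_open k d.+1 :=
  [set 'X_ord_max].
Arguments param_space k d : clear implicits.

Section ArtinSchreier.
Context (p d : nat) (k : fieldType) (a : 'I_d.+1 -> k).

Definition f_poly : {poly k} := \sum_(i < d.+1) a i *: 'X^i.

(* y^p - y - f_a over k(x), with y the polynomial variable *)
Definition artin_schreier_poly : {poly {fraction {poly k}}} :=
  'X^p - 'X - (tofrac f_poly)%:P.

(* k(Y) = k(x)[y]/(y^p - y - f_a).  This is a field when p = char k does not
   divide d and a_d != 0; only its ring structure is needed below. *)
Definition function_field : comNzRingType := {poly %/ artin_schreier_poly}.

(* {poly %/ h} is a quotient by mk_monic h, which is h only if h is monic of
   positive degree. *)
Lemma mk_monic_artin_schreier :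
  (1 < p)%N -> mk_monic artin_schreier_poly = artin_schreier_poly.
Proof.
move=> p_gt1; rewrite /mk_monic /artin_schreier_poly -addrA -opprD.
have lt_sz :
    (size ('X + (tofrac f_poly)%:P)%R <
     size ('X^p : {poly {fraction {poly k}}})%R)%N.
  by rewrite size_polyXn size_XaddC.
rewrite size_polyDl ?size_polyN // size_polyXn ltnS (ltnW p_gt1) /=.
by rewrite monicE lead_coefDl ?size_polyN // lead_coefXn eqxx.
Qed.

Local Notation K := function_field.

Definition cst (c : k) : K := qpolyC artin_schreier_poly (tofrac c%:P).
Definition xK : K := qpolyC artin_schreier_poly (tofrac 'X).
Definition yK : K := qpolyX artin_schreier_poly.

(* The module of differentials of k(Y)/k is free on dx over k(Y); from here on,
   the differential g dx is represented by its coefficient g. *)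

(* C((f_0^p + f_1^p x + ... + f_(p-1)^p x^(p-1)) dx) = f_(p-1) dx.  For k perfect
   of characteristic p, 1, x, ..., x^(p-1) is a basis of k(Y) over k(Y)^p, so c
   exists and is unique. *)
Definition cartier (g : K) : K :=
  xget 0 [set c | exists2 f : nat -> K,
    g = \sum_(i < p) f i ^+ p * xK ^+ i & c = f p.-1].

Definition omega (i j : nat) : K := yK ^+ j.-1 * xK ^+ i.-1.

(* s is a list of (coefficient, vector) pairs. *)
Definition kspan (B : set K) : set K :=
  [set v | exists2 s : seq (k * K),
    (forall u, u \in s -> B u.2) & v = \sum_(u <- s) cst u.1 * u.2].

Definition primeH (J : nat) : set K :=
  kspan [set omega i J | i in
    [set i : nat | [/\ (0 < i)%N, (i * p < (p - J) * d)%N & ~~ (p %| i)%N]]].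

Definition Hspace (l e : nat) : set K :=
  kspan [set omega i l | i in
    [set i : nat | (0 < i <= ((p * (e + 1 - l) - e) * d) %/ p ^ 2)%N]].

Definition coset (N : set K) (v : K) : set K := [set v + n | n in N].

Definition quotient (M N : set K) : set (set K) := [set coset N v | v in M].

(* Families indexed by l = 1, ..., J - 1 are indexed by t : 'I_J.-1, with
   l = t.+1. *)
Definition quotient_sum (J : nat) : set ('I_J.-1 -> set K) :=
  [set q | forall t : 'I_J.-1,
    quotient (Hspace t.+1 J) (Hspace t.+1 J.-1) (q t)].

(* The components of v in the sum of the H(l, J), 1 <= l <= J - 1, which is
   direct because the y^j x^i with j < p are linearly independent over k. *)
Definition components (J : nat) (v : K) : 'I_J.-1 -> K :=
  xget (fun=> 0)
    [set u | (forall t : 'I_J.-1, Hspace t.+1 J (u t)) /\ v = \sum_t u t].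

Definition Phi (J : nat) (w : K) : 'I_J.-1 -> set K :=
  fun t => coset (Hspace t.+1 J.-1) (components (cartier w) t).

Definition Phi_surjective (J : nat) : Prop :=
  set_surj (primeH J) (@quotient_sum J) (@Phi J).

Definition Phi_injective (J : nat) : Prop := set_inj (primeH J) (@Phi J).

End ArtinSchreier.

(* Main.v *)
From HB Require Import structures.
Require Import Defs.
From mathcomp Require Import all_boot all_algebra fingroup perm.
From mathcomp Require Import boolp classical_sets.
From mathcomp.multinomials Require Import mpoly.
From mathcomp Require Import zify ring.

(* Since y = y^p - f, the coefficient of omega_{m,J-r} in C(y^(J-1) P dx) is, up
   to a p-th root and a nonzero binomial factor, the coefficient of x^(pm-1) in
   P f^r.  So Phi_J is described by the matrix of the coefficients [x^(pm-i)] f^r,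
   whose columns are the admissible i and whose rows are the pairs (r, m) with
   0 < r < J and (pr - (J-1))d < p^2 m <= (p(r+1) - J)d; full rank has to be shown
   for generic f.  To a row attach the column |pm - rd|.  For J <= (p+1)/2 this
   maps the rows injectively to the columns; for J >= (p+1)/2 it is a bijection
   from a set of rows to the columns.  In both cases it selects a square minor.

   To see that this minor is a nonzero polynomial in the a_i, put
   f = x^d + e g with g = \sum_(t > 0) T^(t^2) x^(d-t).  At e = 0 the rows with
   pm > rd become unit vectors.  The other rows are divisible by e and leave a
   Hankel matrix with entries r T^((c_i + c_j)^2); since
   \sum_i (c_i + c_s(i))^2 < \sum_i (2 c_i)^2 for a permutation s <> 1, the term
   of the identity has the largest degree in T. *)

Set Implicit Arguments.
Unset Strict Implicit.
Unset Printing Implicit Defensive.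

Import GRing.Theory.
Local Open Scope ring_scope.

(** * A generic minor *)

Lemma size_prod_leq_sum (R : idomainType) (I : finType) (F : I -> {poly R})
    (e : I -> nat) :
  (forall i, size (F i) <= (e i).+1)%N ->
  (size (\prod_i F i)%R <= (\sum_i e i).+1)%N.
Proof.
move=> le_e; elim/big_ind2: _ => [|p q a b lep leq|i _]; last exact: le_e.
  by rewrite size_poly1.
by apply: leq_trans (size_polyMleq _ _) _; lia.
Qed.

(** Reindexing along [s] turns the right side into the sum of 2 c_i^2 + 2 c_(s i)^2, which exceeds
    the left side by the sum of the (c_i - c_(s i))^2; an index moved by [s] makes this positive. *)
Lemma sum_sq_perm_ltn n (c : 'I_n -> nat) (s : 'S_n) :
  injective c -> s != 1%g ->
  (\sum_i (c i + c (s i)) ^ 2 < \sum_i (c i + c i) ^ 2)%N.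
Proof.
move=> inj_c s1; have [i0 si0] : exists i, s i != i.
  apply/existsP; apply: contraNT s1; rewrite negb_exists => /forallP fix_s.
  by apply/eqP/permP => i; rewrite perm1; apply/eqP; move: (fix_s i); rewrite negbK.
have -> : (\sum_i (c i + c i) ^ 2 = \sum_i (2 * c i ^ 2 + 2 * c (s i) ^ 2))%N.
  have := reindex_inj (@perm_inj _ s) (P := xpredT) (F := fun i => 2 * c i ^ 2)%N.
  move/(_ addn 0%N) => /= reidx; rewrite big_split /= -reidx -big_split.
  by apply: eq_bigr => i _ /=; nia.
rewrite (bigD1 i0) //= [ltnRHS](bigD1 i0) //=.
have neq : c i0 != c (s i0) by rewrite (inj_eq inj_c) eq_sym.
rewrite -addSn leq_add //.
  rewrite sqrnD; have := nat_Cauchy (c i0) (c (s i0)) => /ltn_leqif.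
  by rewrite neq; lia.
apply: leq_sum => i _.
by rewrite sqrnD; case: (nat_Cauchy (c i) (c (s i))); lia.
Qed.

(** Let D be the degree of the identity term. A permutation moving an index in [b] meets a zero
    entry, and any other s <> 1 gives a term of degree below D, so the coefficient at D is the
    product of the u_i. *)
Lemma det_hankel_neq0 (R : idomainType) n (c : 'I_n -> nat) (b : pred 'I_n)
    (u : 'I_n -> R) (A : 'M[{poly R}]_n) :
  injective c -> (forall i, u i != 0) ->
  (forall i j, b i -> A i j = (u i)%:P *+ (i == j)) ->
  (forall i, ~~ b i -> A i i = u i *: 'X^((c i + c i) ^ 2)) ->
  (forall i j, ~~ b i -> size (A i j) <= ((c i + c j) ^ 2).+1)%N ->
  \det A != 0.
Proof.
move=> inj_c u0 Ab Adiag Asize.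
pose e i j := (if b i then 0 else (c i + c j) ^ 2)%N.
pose D := (\sum_i e i i)%N.
suff: (\det A)`_D != 0 by apply: contraNneq => ->; rewrite coef0.
rewrite /determinant coef_sum (bigD1 1%g) //= [X in _ + X]big1 => [|s s1].
  rewrite addr0 odd_perm1 expr0 mul1r.
  have -> : \prod_i A i ((1%g : 'S_n) i) = (\prod_i u i) *: 'X^D.
    rewrite -prodrXr -scaler_prod; apply: eq_bigr => i _; rewrite perm1 /e.
    by case: (boolP (b i)) => bi; [rewrite Ab // eqxx expr0 alg_polyC | exact: Adiag].
  by rewrite coefZ coefXn eqxx mulr1; apply/prodf_neq0.
rewrite mulr_sign; suff cf0 : (\prod_i A i (s i))`_D = 0.
  by case: (s : bool); rewrite ?coefN cf0 ?oppr0.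
have [fix_s|] := boolP [forall i, b i ==> (s i == i)]; last first.
  rewrite negb_forall => /existsP[i]; rewrite negb_imply => /andP[bi si].
  by rewrite (bigD1 i) //= Ab // eq_sym (negPf si) mul0r coef0.
apply: nth_default; apply: leq_trans (size_prod_leq_sum (e := fun i => e i (s i)) _) _.
  move=> i; rewrite /e; case: ifP => bi; last by apply: Asize; rewrite bi.
  by move/forallP/(_ i): fix_s; rewrite Ab // bi => /eqP->; rewrite eqxx size_polyC u0.
(* [f] restores the squares of the rows in [b], which [s] fixes, so that the inequality over all
   indices applies. *)
pose f i := (if b i then (c i + c i) ^ 2 else 0)%N.
have := sum_sq_perm_ltn inj_c s1.
have -> : (\sum_i (c i + c i) ^ 2 = D + \sum_i f i)%N.
  rewrite -big_split; apply: eq_bigr => i _; rewrite /e /f /=.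
  by case: ifP; rewrite ?addn0.
have -> : (\sum_i (c i + c (s i)) ^ 2 = \sum_i e i (s i) + \sum_i f i)%N.
  rewrite -big_split; apply: eq_bigr => i _; rewrite /e /f /=.
  case: ifP; rewrite ?addn0 // => bi.
  by move/forallP/(_ i): fix_s; rewrite bi => /eqP->.
by rewrite ltn_add2r.
Qed.

(** The entry is [x^(N_i - c_j)] f^(r_i). The factor x^(c_j) avoids a truncated subtraction and
    gives 0 when c_j > N_i. *)
Definition pencil_mx (R : comNzRingType) n d (N r c : 'I_n -> nat)
    (a : 'I_d.+1 -> R) : 'M[R]_n :=
  \matrix_(i, j) ('X^(c j) * (\sum_(l < d.+1) a l *: 'X^l) ^+ r i)`_(N i).

(** Two orders in [e] suffice: the rows that become unit vectors are read at order 0, the others at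
    order 1. *)
Lemma exprD_order2 (R : comNzRingType) (u e g : R) r :
  exists G, (u + e * g) ^+ r.+1 =
            u ^+ r.+1 + e * (r.+1%:R * u ^+ r * g) + e ^+ 2 * G.
Proof.
elim: r => [|r [G IH]]; first by exists 0; rewrite !expr1 expr0; ring.
exists (u * G + r.+1%:R * u ^+ r * g ^+ 2 + e * g * G).
by rewrite exprS IH -[r.+2%:R]natr1 [u ^+ r.+2]exprS [u ^+ r.+1]exprS; ring.
Qed.

Lemma det_pencil_mx_special (k : idomainType) n d (N r c : 'I_n -> nat) :
  injective c -> (forall i, (r i)%:R != 0 :> k) ->
  (forall i, N i = (r i * d + c i)%N \/
    [/\ (N i + c i = r i * d)%N, (0 < c i)%N & (2 * c i <= d)%N]) ->
  exists a : 'I_d.+1 -> {poly {poly k}}, \det (pencil_mx N r c a) != 0.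
Proof.
move=> inj_c r0 NP.
pose g : {poly {poly k}} := \poly_(l < d) 'X^((d - l) ^ 2).
(* The outer variable is e, the inner one is T. *)
pose a (l : 'I_d.+1) : {poly {poly k}} :=
  if (l < d)%N then 'X * ('X^((d - l) ^ 2))%:P else 1.
exists a; set A := pencil_mx _ _ _ _.
have fE : \sum_(l < d.+1) a l *: 'X^l = 'X^d + 'X%:P * map_poly polyC g.
  rewrite big_ord_recr /= /a ltnn scale1r addrC; congr (_ + _).
  rewrite /g poly_def rmorph_sum mulr_sumr; apply: eq_bigr => l _ /=.
  by rewrite ltn_ord map_polyZ map_polyXn -!mul_polyC polyCM mulrA.
have r_gt0 i : (0 < r i)%N by rewrite lt0n; apply: contraNneq (r0 i) => ->.
have AE i j : exists G, A i j = (N i == c j + r i * d)%:R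
    + 'X * ((r i)%:R * ('X^(c j + (r i).-1 * d) * g)`_(N i))%:P + 'X ^+ 2 * G.
  have [G EG] := exprD_order2 'X^d 'X%:P (map_poly polyC g) (r i).-1.
  exists ('X^(c j) * G)`_(N i).
  rewrite mxE fE -[r i]prednK // EG !mulrDr !coefD -exprM -exprD coefXn.
  rewrite (mulnC d); congr (_ + _ + _).
    rewrite [LHS](_ : _ = ('X%:P * ((r i).-1.+1%:R * map_poly polyC
              ('X^(c j + (r i).-1 * d) * g)))`_(N i)); last first.
      apply: (congr1 (fun q : {poly {poly {poly k}}} => q`_(N i))).
      by rewrite rmorphM /= map_polyXn exprD (mulnC _ d) exprM; ring.
    by rewrite coefCM mulr_natl coefMn coef_map polyCM polyCMn polyC1 mulr_natl.
  by rewrite mulrCA -polyC_exp coefCM.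
clearbody A; pose b i := N i == (r i * d + c i)%N.
have A0 i j : (A i j)`_0 = (N i == c j + r i * d)%:R.
  have [G ->] := AE i j; rewrite expr2 -mulrA.
  by rewrite !coefD !coefXM /= !addr0 -polyC_natr coefC.
have A1 i j : (A i j)`_1 = (r i)%:R * ('X^(c j + (r i).-1 * d) * g)`_(N i).
  have [G ->] := AE i j; rewrite expr2 -mulrA.
  by rewrite !coefD !coefXM /= addr0 -polyC_natr !coefC /= add0r.
(* Rows outside [b] have no constant term in e. [B] is [A] with these rows divided by e, and it is
   then evaluated at e = 0. *)
pose B : 'M[{poly {poly k}}]_n :=
  \matrix_(i, j) if b i then A i j else drop_poly 1 (A i j).
have A0b i j : ~~ b i -> (A i j)`_0 = 0.
  rewrite A0 /b => bi; case: eqP => // Ni; case: (NP i) => [Ni'|[Ni' c0 _]].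
    by rewrite Ni' eqxx in bi.
  lia.
have -> : A = diag_mx (\row_i if b i then 1 else 'X) *m B.
  apply/matrixP => i j; rewrite mul_diag_mx !mxE.
  case: (boolP (b i)) => bi; first by rewrite mul1r.
  have take0 : take_poly 1 (A i j) = 0.
    by apply/polyP => -[|l]; rewrite coef_take_poly coef0 //= A0b.
  by rewrite -[LHS](poly_take_drop 1) take0 add0r expr1 mulrC.
rewrite det_mulmx mulf_neq0 //.
  rewrite det_diag; apply/prodf_neq0 => i _.
  by rewrite mxE; case: ifP; rewrite ?oner_eq0 ?polyX_eq0.
suff : \det (map_mx (horner_eval 0) B) != 0.
  by rewrite det_map_mx; apply: contraNneq => ->; rewrite rmorph0.
apply: (@det_hankel_neq0 _ _ c b (fun i => if b i then 1 else (r i)%:R)) => //.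
- by move=> i; case: ifP => // _; exact: oner_neq0.
- move=> i j bi; rewrite !mxE bi /horner_eval horner_coef0 A0 (eqP bi) addnC.
  by rewrite eqn_add2r (inj_eq inj_c) polyC1.
all: have NB i : ~~ b i -> [/\ (N i + c i = r i * d)%N, (0 < c i)%N & (2 * c i <= d)%N]
  by move=> bi; case: (NP i) => // Ni; rewrite /b Ni eqxx in bi.
(* Here N_i - c_j - (r_i - 1) d = d - (c_i + c_j), and the coefficient of x^(d-s) in [g] is T^(s^2)
   for 0 < s <= d. The bound 2 c_i <= d keeps the diagonal entries nonzero. *)
all: have BE i j : ~~ b i -> (map_mx (horner_eval 0) B) i j
  = if (c i + c j <= d)%N then (r i)%:R *: 'X^((c i + c j) ^ 2) else 0.
- 1,3: move=> bi; rewrite !mxE (negPf bi) /horner_eval horner_coef0 coef_drop_poly A1.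
  1,2: have [Ni ci _] := NB _ bi; rewrite coefXnM.
  1,2: have rd : (r i * d = (r i).-1 * d + d)%N by rewrite -{1}[r i]prednK // mulSn addnC.
  1,2: case: (leqP (c i + c j) d) => cd; last by rewrite ifT ?mulr0 //; lia.
  1,2: rewrite ifF; last by apply/negbTE; lia.
  1,2: rewrite coef_poly ifT; last by lia.
  1,2: rewrite scaler_nat mulr_natl; congr (_ *+ _); congr ('X^(_ ^ 2)); lia.
- by move=> i bi; rewrite BE // (negPf bi); have [_ _ /= ci] := NB _ bi; rewrite ifT //; lia.
- move=> i j bi; rewrite BE //; case: ifP => _; last by rewrite size_poly0.
  by rewrite size_scale ?size_polyXn.
Qed.

(** * The function field and its Cartier operator *)

Lemma fractionP (R : idomainType) (x : {fraction R}) :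
  exists n d : R, d != 0 /\ x = tofrac n / tofrac d.
Proof.
elim/quotW: x => x; exists x.1, x.2; split; first exact: denom_ratioP.
apply: (canRL (mulfK _)); first by rewrite tofrac_eq0 denom_ratioP.
rewrite !piE.
apply/eqmodP; rewrite /= FracField.equivfE /FracField.mulf.
rewrite !numden_Ratio ?mulr1 ?mul1r ?mulf_neq0 ?oner_neq0 ?denom_ratioP //.
by rewrite mulrC.
Qed.

Lemma fraction_common_den (R : idomainType) n (u : 'I_n -> {fraction R}) :
  exists D : R, exists2 m : 'I_n -> R,
    D != 0 & forall i, tofrac (m i) = u i * tofrac D.
Proof.
have /fin_all_exists[nd ndP] i : exists nd : R * R,
    nd.2 != 0 /\ u i = tofrac nd.1 / tofrac nd.2.
  by have [a [b [b0 ->]]] := fractionP (u i); exists (a, b).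
exists (\prod_i (nd i).2); exists (fun i => (nd i).1 * \prod_(j | j != i) (nd j).2).
  by apply/prodf_neq0 => i _; case: (ndP i).
move=> i; have [d0 ->] := ndP i.
by rewrite [in RHS](bigD1 i) //= !tofracM mulrA divfK // tofrac_eq0.
Qed.

(** Frobenius is additive, so P^p is a polynomial in x^p whose coefficients are the p-th powers of
    those of P. *)
Lemma coef_exp_pchar (R : comNzRingType) p (charR : p \in [pchar R])
    (P : {poly R}) i :
  (P ^+ p)`_i = if (p %| i)%N then P`_(i %/ p) ^+ p else 0.
Proof.
have charP : p \in [pchar {poly R}] := rmorph_pchar polyC charR.
have p_gt0 := prime_gt0 (pcharf_prime charR).
have -> : P ^+ p = (\poly_(i < size P) P`_i ^+ p) \Po 'X^p.
  rewrite -(pFrobenius_autE charP) -{1}[P]coefK !poly_def !raddf_sum /=.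
  apply: eq_bigr => j _; rewrite comp_polyZ comp_Xn_poly.
  by rewrite pFrobenius_autE exprZn -!exprM mulnC.
rewrite coef_comp_poly_Xn // coef_poly; case: ifP => // _; case: ltnP => // le_P.
by rewrite nth_default // expr0n gtn_eqF.
Qed.

Lemma exp_pchar_sum_eq0 (R : idomainType) p (charR : p \in [pchar R])
    (m : 'I_p -> {poly R}) :
  \sum_i m i ^+ p * 'X^i = 0 -> forall i, m i = 0.
Proof.
move=> m0 i; apply/polyP => n; rewrite coef0; apply/eqP.
have p_gt0 := prime_gt0 (pcharf_prime charR).
have /eqP := congr1 (fun P : {poly R} => P`_(n * p + i)) m0.
rewrite coef0 coef_sum (bigD1 i) //= big1 ?addr0 => [|j ji].
  rewrite coefMXn ltnNge leq_addl /= addnK coef_exp_pchar //.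
  by rewrite dvdn_mull // mulnK // expf_eq0 p_gt0.
rewrite coefMXn; case: ltnP => // le_j; rewrite coef_exp_pchar //.
case: ifP => // /dvdnP[q Eq]; case/eqP: ji; apply: val_inj => /=.
have E : (n * p + i = q * p + j)%N by lia.
by have := congr1 (modn^~ p) E; rewrite !modnMDl !modn_small.
Qed.

(** Multiplying by D^p, with D a common denominator, keeps the coefficients p-th powers and reduces
    to polynomials. *)
Lemma fraction_exp_pchar_sum_eq0 (R : fieldType) p (charR : p \in [pchar R])
    (u : 'I_p -> {fraction {poly R}}) :
  \sum_i u i ^+ p * tofrac 'X ^+ i = 0 -> forall i, u i = 0.
Proof.
move=> u0 i; have [D [m D0 mE]] := fraction_common_den u.
have F0 : tofrac D != 0 by rewrite tofrac_eq0.
apply: (mulIf F0); rewrite mul0r -mE; apply/eqP; rewrite tofrac_eq0; apply/eqP.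
apply: (exp_pchar_sum_eq0 charR); apply/eqP; rewrite -tofrac_eq0; apply/eqP.
transitivity (tofrac D ^+ p * \sum_i u i ^+ p * tofrac 'X ^+ i).
  rewrite rmorph_sum mulr_sumr; apply: eq_bigr => j _.
  by rewrite rmorphM !rmorphXn /= mE exprMn mulrCA mulrA.
by rewrite u0 mulr0.
Qed.

Definition polyK p d (k : fieldType) (a : 'I_d.+1 -> k) (P : {poly k}) :
  function_field p a := qpolyC (artin_schreier_poly p a) (tofrac P).

HB.instance Definition _ p d (k : fieldType) (a : 'I_d.+1 -> k) :=
  GRing.RMorphism.copy (polyK p a)
    (qpolyC (artin_schreier_poly p a) \o @tofrac {poly k}).

(** * The basis 1, y, ..., y^(p-1) over k(x), and independence over p-th powers *)

Section FunctionField.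
Context (p d : nat) (k : fieldType) (a : 'I_d.+1 -> k).
Context (charK : p \in [pchar k]).
Local Notation K := (function_field p a).
Local Notation h := (artin_schreier_poly p a).
Local Notation F := {fraction {poly k}}.
Local Notation y := (yK p a : K).
Local Notation E := (polyK p a).
Local Notation qC := (qpolyC h : F -> K).

Lemma p_gt1 : (1 < p)%N. Proof. exact: prime_gt1 (pcharf_prime charK). Qed.

Lemma size_artin_schreier_poly : size h = p.+1.
Proof.
have := p_gt1 => p_gt1.
rewrite /artin_schreier_poly -addrA -opprD size_polyDl ?size_polyN size_polyXn //.
by rewrite size_XaddC.
Qed.

Lemma size_mk_monic_artin_schreier : size (mk_monic h) = p.+1.
Proof. by rewrite mk_monic_artin_schreier ?p_gt1 // size_artin_schreier_poly. Qed.

Lemma polyn_in_qpoly (P : {poly F}) :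
  (size P <= p)%N -> qpoly.polyn (in_qpoly h P) = P.
Proof. by move=> sP; rewrite in_qpoly_small // size_mk_monic_artin_schreier. Qed.

Lemma in_qpoly_eq0 (P : {poly F}) :
  (size P <= p)%N -> in_qpoly h P = 0 :> K -> P = 0.
Proof. by move=> /polyn_in_qpoly + P0; rewrite P0 => <-. Qed.

Lemma qpolyC_in_qpoly (c : F) : qC c = in_qpoly h c%:P.
Proof.
apply: val_inj; apply/esym/polyn_in_qpoly.
by rewrite (leq_trans (size_polyC_leq1 _)) // ltnW ?p_gt1.
Qed.

Lemma size_sumZXn n (v : 'I_n -> F) : (size (\sum_j v j *: 'X^j)%R <= n)%N.
Proof.
apply: leq_trans (size_sum _ _ _) _; apply/bigmax_leqP => i _.
by apply: leq_trans (size_scale_leq _ _) _; rewrite size_polyXn.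
Qed.

Lemma sumZXn_eq0 n (v : 'I_n -> F) :
  \sum_j v j *: 'X^j = 0 -> forall j, v j = 0.
Proof.
move=> v0 j; move/(congr1 (fun P : {poly F} => P`_j)): v0.
rewrite coef0 coef_sum (bigD1 j) //= coefZ coefXn eqxx mulr1 big1 ?addr0 // => i ij.
by rewrite coefZ coefXn eq_sym [_ == _](negPf ij) mulr0.
Qed.

Lemma in_qpoly_sum n (u : 'I_n -> F) :
  \sum_(j < _) y ^+ j * qC (u j) = in_qpoly h (\sum_j u j *: 'X^j).
Proof.
rewrite rmorph_sum; apply: eq_bigr => j _ /=.
by rewrite -mul_polyC rmorphM rmorphXn /= -qpolyC_in_qpoly mulrC.
Qed.

Lemma yK_free n (u : 'I_n -> F) :
  (n <= p)%N -> \sum_(j < n) y ^+ j * qC (u j) = 0 -> forall j, u j = 0.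
Proof.
move=> le_np; rewrite in_qpoly_sum => /in_qpoly_eq0 u0.
exact: sumZXn_eq0 (u0 (leq_trans (size_sumZXn _) le_np)).
Qed.

Lemma yK_span (w : K) :
  exists u : 'I_p -> F, w = \sum_(j < _) y ^+ j * qC (u j).
Proof.
have sw : (size (qpoly.polyn w) <= p)%N.
  by apply: leq_trans (size_npoly w) _; rewrite size_mk_monic_artin_schreier.
exists (fun j => (qpoly.polyn w)`_j); rewrite in_qpoly_sum; apply: val_inj => /=.
rewrite -[LHS](polyn_in_qpoly sw); congr (qpoly.polyn (in_qpoly _ _)).
rewrite -poly_def; apply/polyP => j; rewrite coef_poly; case: ltnP => // le_j.
by rewrite nth_default // (leq_trans sw).
Qed.

Lemma yK_exp : y ^+ p = y + E (f_poly a).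
Proof.
have : in_qpoly h h = 0 :> K.
  apply: val_inj => /=; rewrite /in_qpoly mk_monic_artin_schreier ?p_gt1 //=.
  apply: Pdiv.RingMonic.rmodpp; rewrite -(mk_monic_artin_schreier a p_gt1).
  exact: monic_mk_monic.
rewrite {2}/artin_schreier_poly !rmorphB rmorphXn /= -qpolyC_in_qpoly.
by move/eqP; rewrite subr_eq0 subr_eq addrC => /eqP.
Qed.

Lemma pchar_function_field : p \in [pchar K].
Proof.
have charP : p \in [pchar {poly k}] := rmorph_pchar polyC charK.
exact: (rmorph_pchar (E : {rmorphism {poly k} -> K}) charP).
Qed.

Lemma exp_pchar_sum n (u : 'I_n -> K) : (\sum_i u i) ^+ p = \sum_i u i ^+ p.
Proof.
rewrite -(pFrobenius_autE pchar_function_field) rmorph_sum.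
by apply: eq_bigr => i _; rewrite /= pFrobenius_autE.
Qed.

Lemma exp_pchar_sub (u v : K) : (u - v) ^+ p = u ^+ p - v ^+ p.
Proof. by rewrite -!(pFrobenius_autE pchar_function_field) rmorphB. Qed.

(** This gives the uniqueness of the value of [cartier]. Write f_i = \sum_j u_ij y^j. Since y^p = y
    + f_a, the sum is V(y + f_a) with V = \sum_j v_j Y^j and v_j = \sum_i u_ij^p x^i. As V(Y + f_a)
    has degree below p, it vanishes as a polynomial; so V = 0, and v_j = 0 forces u_ij = 0 in
    k(x). *)
Lemma xK_exp_free (f : 'I_p -> K) :
  \sum_i f i ^+ p * xK p a ^+ i = 0 -> forall i, f i = 0.
Proof.
move=> f0 i; have /fin_all_exists[u uE] i := yK_span (f i).
rewrite uE big1 // => j _; suff -> : u i j = 0 by rewrite qpolyC0 mulr0.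
apply: (fraction_exp_pchar_sum_eq0 charK (u := u^~ j)).
pose v (l : 'I_p) : F := \sum_i u i l ^+ p * tofrac 'X ^+ i.
have vE t : qC (v t) = \sum_i qC (u i t ^+ p * tofrac 'X ^+ i) by exact: rmorph_sum.
have yE : in_qpoly h ('X + (tofrac (f_poly a))%:P) = y + E (f_poly a).
  by rewrite rmorphD /= -qpolyC_in_qpoly.
have : \sum_i f i ^+ p * xK p a ^+ i =
       in_qpoly h ((\sum_j v j *: 'X^j) \Po ('X + (tofrac (f_poly a))%:P)).
  rewrite raddf_sum rmorph_sum.
  transitivity (\sum_i \sum_(j < p)
      (y + E (f_poly a)) ^+ j * qC (u i j ^+ p * tofrac 'X ^+ i)).
    apply: eq_bigr => l _; rewrite uE exp_pchar_sum mulr_suml; apply: eq_bigr => t _.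
    by rewrite exprMn -exprM mulnC exprM yK_exp rmorphM !rmorphXn /= mulrA.
  rewrite exchange_big; apply: eq_bigr => t _ /=.
  rewrite comp_polyZ comp_Xn_poly -mul_polyC rmorphM rmorphXn /= yE.
  by rewrite -qpolyC_in_qpoly vE -mulr_sumr; exact: mulrC.
rewrite f0 => /esym/in_qpoly_eq0.
rewrite size_comp_poly2 ?size_XaddC // => /(_ (size_sumZXn _)) /eqP.
by rewrite comp_poly2_eq0 ?size_XaddC // => /eqP/sumZXn_eq0/(_ j).
Qed.

End FunctionField.

(** * The Cartier operator on polynomials in x and y *)

Section CartierOperator.
Context (p d : nat) (k : fieldType) (a : 'I_d.+1 -> k).
Context (proot : k -> k).
Context (charK : p \in [pchar k]).
Context (prootK : forall c, proot c ^+ p = c).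
Local Notation K := (function_field p a).
Local Notation y := (yK p a : K).
Local Notation E := (polyK p a).

Let p_gt0 : (0 < p)%N := ltnW (p_gt1 charK).

(** The polynomial P_i in P = \sum_(i < p) P_i^p x^i; [size P] is only a crude degree bound. *)
Definition root_section (i : nat) (P : {poly k}) : {poly k} :=
  \poly_(n < size P) proot P`_(n * p + i).

Lemma proot0 : proot 0 = 0.
Proof. by apply/eqP; rewrite -[_ == _]andTb -p_gt0 -expf_eq0 prootK. Qed.

Lemma proot_inj : injective proot.
Proof. by move=> c c' E; rewrite -[c]prootK E prootK. Qed.

Lemma exp_pchar_inj : injective (fun c : k => c ^+ p).
Proof.
move=> c c' /= E; apply: (fmorph_inj (pFrobenius_aut charK)).
by rewrite /= !pFrobenius_autE.
Qed.

Lemma coef_root_section i P n : (root_section i P)`_n = proot P`_(n * p + i).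
Proof.
rewrite coef_poly; case: ltnP => // le_n; rewrite [P`__]nth_default ?proot0 //.
by apply: leq_trans le_n _; nia.
Qed.

Lemma root_section_sum P : P = \sum_(i < p) root_section i P ^+ p * 'X^i.
Proof.
apply/polyP => n; have lt_i : (n %% p < p)%N by rewrite ltn_mod.
rewrite coef_sum (bigD1 (Ordinal lt_i)) //= big1 => [|j ji].
  rewrite coefMXn ltnNge leq_mod addr0 /= coef_exp_pchar //.
  have -> : (n - n %% p = n %/ p * p)%N by rewrite {1}(divn_eq n p) addnK.
  by rewrite dvdn_mull // mulnK // coef_root_section prootK -divn_eq.
rewrite coefMXn; case: ltnP => // le_j; rewrite coef_exp_pchar //.
case: ifP => // /dvdnP[q Eq]; case/eqP: ji; apply: val_inj => /=.
have -> : n = (q * p + j)%N by lia.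
by rewrite modnMDl modn_small.
Qed.

(** Splitting each F_l by residues of exponents and collecting by i gives the coordinates f_i =
    \sum_l y^l F_(l,i). By [xK_exp_free] they are the only ones, so [xget] returns the last of
    them. *)
Lemma cartier_sum n (F : 'I_n -> {poly k}) :
  cartier (\sum_(l < n) y ^+ (l * p) * E (F l)) =
  \sum_(l < n) y ^+ l * E (root_section p.-1 (F l)).
Proof.
pose f i : K := \sum_(l < n) y ^+ l * E (root_section i (F l)).
have fE : \sum_(l < n) y ^+ (l * p) * E (F l) = \sum_(i < p) f i ^+ p * xK p a ^+ i.
  transitivity (\sum_(i < p) \sum_(l < n)
      y ^+ (l * p) * E (root_section i (F l) ^+ p * 'X^i)).
    rewrite exchange_big; apply: eq_bigr => l _ /=.
    by rewrite -mulr_sumr {1}(root_section_sum (F l)) rmorph_sum.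
  apply: eq_bigr => i _; rewrite /f (exp_pchar_sum charK) mulr_suml.
  by apply: eq_bigr => l _; rewrite exprMn exprM rmorphM !rmorphXn /= mulrA.
apply: xget_unique; first by exists f.
move=> _ [f' f'E ->]; rewrite fE in f'E.
have lt_p : (p.-1 < p)%N by rewrite prednK.
apply/eqP; rewrite -subr_eq0; apply/eqP.
apply: (xK_exp_free charK (f := fun i : 'I_p => f' i - f i) _ (Ordinal lt_p)).
transitivity (\sum_(i < p) (f' i ^+ p * xK p a ^+ i - f i ^+ p * xK p a ^+ i)).
  by apply: eq_bigr => i _; rewrite (exp_pchar_sub charK) mulrBl.
by rewrite sumrB -f'E subrr.
Qed.

(** Substituting y = y^p - f leaves only powers of y^p, which C turns into powers of y. *)
Lemma cartier_yK n (P : {poly k}) :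
  cartier (y ^+ n * E P) = \sum_(l < n.+1)
    y ^+ l * E (root_section p.-1 (P * (- f_poly a) ^+ (n - l) *+ 'C(n, l))).
Proof.
rewrite -cartier_sum; congr cartier.
have {1}-> : y = - E (f_poly a) + y ^+ p by rewrite (yK_exp _ charK) addrC addrK.
rewrite exprDn mulr_suml; apply: eq_bigr => l _.
by rewrite -exprM mulnC rmorphMn rmorphM rmorphXn rmorphN /=; ring.
Qed.

Lemma yK_polyK_inj n (V V' : 'I_n -> {poly k}) : (n <= p)%N ->
  \sum_(j < n) y ^+ j * E (V j) = \sum_(j < n) y ^+ j * E (V' j) ->
  forall j, V j = V' j.
Proof.
move=> le_np /eqP; rewrite -subr_eq0 -sumrB => /eqP VV' j.
apply/eqP; rewrite -subr_eq0 -tofrac_eq0; apply/eqP.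
apply: (yK_free (a := a) charK le_np (u := fun j => tofrac (V j - V' j))).
by rewrite -[RHS]VV'; apply: eq_bigr => i _; rewrite -mulrBr -rmorphB.
Qed.

(** Membership in [primeH] or [Hspace] thus becomes a condition on the support of one polynomial;
    the index i of omega corresponds to the exponent i - 1. *)
Lemma kspan_omega (I : set nat) (l : nat) (v : K) : (forall i, I i -> 0 < i)%N ->
  kspan [set omega p a i l | i in I]%classic v <->
  exists2 P : {poly k}, (forall i, P`_i != 0 -> I i.+1) & v = y ^+ l.-1 * E P.
Proof.
move=> I_gt0; split=> [[s sI ->]|[P PI ->]].
  elim: s sI => [|[c u] s IH] sI.
    by exists 0 => [i|]; rewrite ?coef0 ?eqxx // big_nil rmorph0 mulr0.
  have [|P PI PE] := IH; first by move=> w ws; apply: sI; rewrite inE ws orbT.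
  have [i Ii /= uE] := sI (c, u) (mem_head _ _).
  exists (c%:P * 'X^(i.-1) + P) => [j|].
    rewrite coefD coefCM coefXn; case: (eqVneq j i.-1) => [-> _|_].
      by rewrite prednK // I_gt0.
    by rewrite mulr0 add0r => /PI.
  rewrite big_cons PE -uE /omega rmorphD mulrDr /= rmorphM rmorphXn /=.
  by congr (_ + _); rewrite mulrCA.
exists [seq (P`_i, omega p a i.+1 l) | i <- iota 0 (size P) & P`_i != 0].
  by move=> u /mapP[i]; rewrite mem_filter => /andP[Pi _] -> /=; exists i.+1; auto.
rewrite big_map big_filter -{1}[P]coefK poly_def rmorph_sum mulr_sumr.
rewrite -(big_mkord xpredT (fun i => y ^+ l.-1 * E (P`_i *: 'X^i))).
rewrite /index_iota subn0 [RHS]big_mkcond; apply: eq_bigr => i _ /=.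
case: eqP => [->|_] /=; first by rewrite scale0r rmorph0 mulr0.
by rewrite -mul_polyC rmorphM rmorphXn /= mulrCA.
Qed.

Lemma coset_eqP (N : set K) (v v' : K) : N 0 ->
  (forall u w, N u -> N w -> N (u - w)) ->
  Defs.coset N v = Defs.coset N v' <-> N (v - v').
Proof.
move=> N0 NB; split=> [vv'|Nvv'].
  have : Defs.coset N v v by exists 0; rewrite ?addr0.
  by rewrite vv' => -[n Nn <-]; rewrite addrC addKr.
have ND u w : N u -> N w -> N (u + w).
  by move=> Nu Nw; rewrite -[w]opprK; apply: (NB _ _ Nu); rewrite -sub0r; apply: NB.
apply/seteqP; split=> _ [n Nn <-].
  by exists (n + (v - v')); [exact: ND | rewrite addrCA subrKC addrC].
by exists (n - (v - v')); [exact: NB | rewrite opprB addrCA subrKC addrC].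
Qed.

End CartierOperator.

(** * The index set of the minor *)

Local Close Scope ring_scope.

(** The row (r, m) stands for the class of omega_(m,J-r) in H(J-r, J) / H(J-r, J-1); the factor p^2
    clears the floors in the two bounds. *)
Definition in_row_range p d J (r m : nat) : bool :=
  [&& 0 < r < J, (p * r - J.-1) * d < m * p ^ 2 & m * p ^ 2 <= (p * r.+1 - J) * d].

Definition in_col_range p d J (c : nat) : bool :=
  [&& 0 < c, c * p < (p - J) * d & ~~ (p %| c)].

Lemma prime_ndvd_mul p d r : prime p -> ~~ (p %| d) -> 0 < r < p -> ~~ (p %| r * d).
Proof.
move=> p_pr ndvd /andP[r0 rp]; rewrite Euclid_dvdM // negb_or ndvd andbT.
by apply/negP => /dvdn_leq; lia.
Qed.

(** Since J d <= p d <= p r d, no subtraction truncates and every term can be moved to the side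
    where it is positive. *)
Lemma in_row_rangeE p d J r m : 1 < J < p -> in_row_range p d J r m =
  [&& 0 < r < J, p * (r * d) + d < p * (p * m) + J * d
    & p * (p * m) + J * d <= p * (r * d) + p * d].
Proof.
move=> /andP[J1 Jp]; rewrite /in_row_range; case: (boolP (0 < r < J)) => //= /andP[r0 _].
have pJ : J * d <= p * d by rewrite leq_mul2r ltnW ?orbT.
have pr : p * d <= p * (r * d) by rewrite leq_mul2l leq_pmull ?orbT.
have J1d : J.-1 * d + d = J * d by rewrite addnC -mulSn prednK // ltnW.
rewrite !mulnBl -!mulnA mulSn mulnDr (_ : m * p ^ 2 = p * (p * m)); last first.
  by rewrite mulnC -mulnn mulnA.
by apply/idP/idP => /andP[lo up]; apply/andP; split; lia.
Qed.

Lemma row_rangeP p d J r m : 1 < J < p -> in_row_range p d J r m ->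
  [/\ 0 < r < J, p * (r * d) + d < p * (p * m) + J * d
    & p * (p * m) + J * d <= p * (r * d) + p * d].
Proof. by move=> J_range; rewrite in_row_rangeE // => /and3P[]. Qed.

Section IndexData.
Context (p d J : nat).
Context (p_pr : prime p) (p_odd : odd p) (p_ndvd_d : ~~ (p %| d)) (J_range : 1 < J < p).

(** The rows of the minor. When pm < rd, the last inequality makes the column admissible, and r <= p
    - J keeps it apart from the columns of the rows with pm > rd. *)
Let row_index (r m : nat) : bool := in_row_range p d J r m &&
  ((r * d < p * m) || ((r <= p - J) && ((r * d - p * m) * p < (p - J) * d))).
(** This is |pm - rd|: one of the truncated differences is always 0. *)
Let col (r m : nat) : nat := (p * m - r * d) + (r * d - p * m).

Let row_range_leq r m : in_row_range p d J r m -> r < p /\ m <= d.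
Proof.
move=> rm; have [/andP[r0 rJ] lo up] := row_rangeP J_range rm.
have [J1 Jp] := andP J_range; split; first exact: ltn_trans Jp.
rewrite -(@leq_pmul2l (p * p)) ?muln_gt0 ?prime_gt0 //.
have : r.+1 * d <= J * d by rewrite leq_mul2r rJ orbT.
have : J * d <= p * d by rewrite leq_mul2r ltnW ?orbT.
have : p * (r.+1 * d) <= p * (J * d) by rewrite leq_mul2l leq_mul2r rJ !orbT.
have : p * (J * d) <= p * (p * d) by rewrite leq_mul2l leq_mul2r ltnW ?orbT.
rewrite mulSn mulnDr -!mulnA; lia.
Qed.

Let row_neq r m : in_row_range p d J r m -> p * m != r * d.
Proof.
move=> rm; have [rp _] := row_range_leq rm; have /andP[/andP[r0 _] _] := rm.
have := prime_ndvd_mul p_pr p_ndvd_d (r := r); rewrite r0 rp => /(_ isT).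
by apply: contraNneq => <-; rewrite dvdn_mulr.
Qed.

(** For pm > rd the upper end of the row range gives p c <= (p - J) d, and equality fails modulo
    p. *)
Let index_col r m : row_index r m -> in_col_range p d J (col r m).
Proof.
case/andP=> rm cond; have neq := row_neq rm; have [rp _] := row_range_leq rm.
have [/andP[r0 rJ] lo up] := row_rangeP J_range rm.
have ndvd := prime_ndvd_mul p_pr p_ndvd_d (r := r).
rewrite r0 rp in ndvd; have {}ndvd := ndvd isT.
have ndvdJ : ~~ (p %| (p - J) * d).
  by apply: prime_ndvd_mul => //; move: J_range; lia.
rewrite /in_col_range /col; case: (ltngtP (p * m) (r * d)) neq cond => //= lt _.
  move=> /andP[_ cp]; have -> : p * m - r * d = 0 by lia.
  rewrite add0n subn_gt0 lt cp /=; apply: contra ndvd => dv.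
  by rewrite -(subnK (ltnW lt)) dvdn_addl // dvdn_mulr.
move=> _; have -> : r * d - p * m = 0 by lia.
rewrite addn0 subn_gt0 lt /=; apply/andP; split.
  rewrite ltn_neqAle; apply/andP; split.
    by apply: contraNneq ndvdJ => <-; rewrite dvdn_mull.
  rewrite !mulnBl (mulnC (p * _)) (mulnC (_ * d)); lia.
apply: contra ndvd => dv; rewrite -(dvdn_addr _ dv) subnK 1?ltnW //.
by rewrite dvdn_mulr.
Qed.

(** If pm - rd and pm' - r'd have the same sign, r and r' agree modulo p, hence are equal. Opposite
    signs would give p | (r + r') d with 0 < r + r' < p. *)
Let index_inj r m r' m' : row_index r m -> row_index r' m' ->
  col r m = col r' m' -> r = r' /\ m = m'.
Proof.
case/andP=> rm cond /andP[rm' cond'].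
have neq := row_neq rm; have neq' := row_neq rm'.
have [rp _] := row_range_leq rm; have [rp' _] := row_range_leq rm'.
have [/andP[r0 rJ] _ _] := row_rangeP J_range rm.
have [/andP[r0' rJ'] _ _] := row_rangeP J_range rm'.
have le_row s t u v : s < p -> s * d + p * u = t * d + p * v -> s <= t.
  move=> sp E; rewrite leqNgt; apply/negP => lt.
  have /negP[] : ~~ (p %| (s - t) * d).
    apply: prime_ndvd_mul => //.
    by rewrite subn_gt0 lt (leq_ltn_trans (leq_subr _ _)).
  have lt' : t * d <= s * d by rewrite leq_mul2r ltnW ?orbT.
  have -> : (s - t) * d = p * (v - u) by rewrite mulnBl mulnBr; lia.
  by rewrite dvdn_mulr.
have conc : r * d + p * m' = r' * d + p * m -> r = r' /\ m = m'.
  move=> E; have rr : r = r'.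
    by apply/eqP; rewrite eqn_leq (le_row _ _ m' m) // (le_row _ _ m m').
  split=> //; apply/eqP; rewrite -(eqn_pmul2l (prime_gt0 p_pr)).
  by move: E; rewrite rr => /addnI ->.
have opp s t u v : 0 < s < J -> t <= p - J -> p * u + p * v = s * d + t * d -> False.
  move=> sJ tJ; rewrite -mulnDr -mulnDl => E.
  have [J1 Jp] := andP J_range.
  have /negP[] : ~~ (p %| (s + t) * d) by apply: prime_ndvd_mul => //; lia.
  by rewrite -E dvdn_mulr.
rewrite /col => E.
case: (ltngtP (p * m) (r * d)) neq cond => //= lt _ cond;
  case: (ltngtP (p * m') (r' * d)) neq' cond' => //= lt' _ cond'.
- by apply: conc; lia.
- by case/andP: cond => rJp _; case: (opp r' r m' m); rewrite ?r0' //; lia.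
- by case/andP: cond' => rJp _; case: (opp r r' m m'); rewrite ?r0 //; lia.
- by apply: conc; lia.
Qed.

Lemma index_data : exists q (m r c : 'I_q -> nat),
  [/\ injective c,
      forall i, in_col_range p d J (c i) && in_row_range p d J (r i) (m i),
      forall i, m i * p = r i * d + c i \/
        [/\ m i * p + c i = r i * d, 0 < c i & 2 * c i <= d],
      J <= (p + 1) %/ 2 -> forall r0 m0, in_row_range p d J r0 m0 ->
        exists i, r i = r0 /\ m i = m0
    & (p + 1) %/ 2 <= J -> forall c0, in_col_range p d J c0 ->
        exists i, c i = c0].
Proof.
pose X := [set x : 'I_p * 'I_d.+1 | row_index x.1 x.2].
pose r (i : 'I_#|X|) : nat := (enum_val i).1.
pose m (i : 'I_#|X|) : nat := (enum_val i).2.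
have memX i : row_index (r i) (m i) by have := enum_valP i; rewrite inE.
have witness r0 m0 : row_index r0 m0 -> exists i, r i = r0 /\ m i = m0.
  move=> rm; have [rp md] := row_range_leq (proj1 (andP rm)).
  have xX : (Ordinal rp, Ordinal (md : m0 < d.+1)) \in X by rewrite inE.
  exists (enum_rank_in xX (Ordinal rp, Ordinal (md : m0 < d.+1))).
  by rewrite /r /m enum_rankK_in.
have [J1 Jp] := andP J_range.
exists #|X|, m, r, (fun i => col (r i) (m i)); split.
- move=> i j /(index_inj (memX i) (memX j))[ri mi]; apply: enum_val_inj.
  move: ri mi; rewrite /r /m; case: (enum_val i) (enum_val j) => [? ?] [? ?] /=.
  by move=> /val_inj -> /val_inj ->.
- by move=> i; rewrite index_col //=; have /andP[] := memX i.
- move=> i; have /andP[rm _] := memX i; have := index_col (memX i).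
  move: (r i) (m i) rm => s t st /and3P[]; have := row_neq st.
  have [/andP[s0 sJ] lo up] := row_rangeP J_range st.
  rewrite /col [t * p]mulnC; case: (ltngtP (p * t) (s * d)) => // lt _ c0 cp _;
    [right | left; lia].
  have cE : p * t - s * d = 0 by lia.
  rewrite cE add0n in c0 cp *; split=> //; first by lia.
  (* Adding p c < (J - 1) d, from the row range, to p c < (p - J) d gives 2 p c < (p - 1) d. *)
  rewrite -(@leq_pmul2l p) ?prime_gt0 //.
  have : J * d <= p * d by rewrite leq_mul2r ltnW ?orbT.
  by move: cp; rewrite !mulnBl; nia.
(* For 2J <= p + 1 every row is kept: r <= J - 1 <= p - J, and p (rd - pm) < (J - 1) d <= (p - J)
   d. *)
- move=> le_J r0 m0 rm; apply: witness; rewrite /row_index rm /=.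
  have := row_neq rm; have [/andP[r0_gt0 r0J] lo up] := row_rangeP J_range rm.
  case: (ltngtP (p * m0) (r0 * d)) => //= lt _.
  have le2 : J + J <= p + 1 by lia.
  apply/andP; split; first lia.
  have : (J + J) * d <= (p + 1) * d by rewrite leq_mul2r le2 orbT.
  by rewrite !mulnBl (mulnC (r0 * d)) (mulnC (p * m0)) !mulnDl mul1n; lia.
move=> le_J c0 /and3P[c0_gt0 c0p ndvd].
have le2 : p + 1 <= J + J by lia.
(* Here p | 1 + a d, so s = c0 a mod p solves c0 + s d = t p. If s < J, the row (s, t) has column
   c0; otherwise the row (p - s, d - t) does, because (p - s) d - p (d - t) = c0. *)
have [a a_lt /dvdnP[u]] := Bezoutl d (prime_gt0 p_pr).
have /eqP -> : coprime p d by rewrite prime_coprime.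
move=> uE; pose s := (c0 * a) %% p.
have sp : s < p by rewrite ltn_mod prime_gt0.
have dvds : p %| c0 + s * d.
  have : p %| c0 + (c0 * a) * d.
    by rewrite -mulnA -[X in X + _]muln1 -mulnDr uE mulnA dvdn_mull.
  by rewrite {1}(divn_eq (c0 * a) p) mulnDl addnCA dvdn_addr // mulnAC dvdn_mull.
have s_gt0 : 0 < s.
  by rewrite lt0n; apply: contraNneq ndvd => s0; rewrite s0 addn0 in dvds.
case/dvdnP: dvds => t tE; clearbody s; clear uE le_J p_odd a a_lt u.
have pJ : J * d <= p * d by rewrite leq_mul2r ltnW ?orbT.
have Jd2 : (p + 1) * d <= (J + J) * d by rewrite leq_mul2r le2 orbT.
have d_gt0 : 0 < d by case: (d) p_ndvd_d; rewrite ?dvdn0.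
rewrite !mulnDl mul1n in Jd2.
rewrite mulnBl in c0p.
have [sJ|Js] := ltnP s J.
  have E : p * (p * t) = p * c0 + p * (s * d) by rewrite -mulnDr tE (mulnC t).
  have [|i [ri mi]] := witness s t; last by exists i; rewrite ri mi /col; lia.
  rewrite /row_index in_row_rangeE // s_gt0 sJ /=; apply/andP; split.
    by apply/andP; split; lia.
  by apply/orP; left; lia.
have c0d : c0 < d.
  by rewrite -(ltn_pmul2l (prime_gt0 p_pr)) mulnC (leq_trans c0p) ?leq_subr.
have td : t <= d.
  rewrite -(leq_pmul2l (prime_gt0 p_pr)) (mulnC p t) -tE.
  have : s.+1 * d <= p * d by rewrite leq_mul2r sp orbT.
  by apply: leq_trans; rewrite mulSn leq_add2r ltnW.
have sd : (p - s) * d + s * d = p * d by rewrite -mulnDl subnK // ltnW.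
have E1 : p * (d - t) + c0 = (p - s) * d.
  apply/eqP; rewrite -(eqn_add2r (s * d)) sd -addnA tE (mulnC t p) -mulnDr.
  by rewrite subnK.
have E2 : p * (p * (d - t)) + p * c0 = p * ((p - s) * d) by rewrite -mulnDr E1.
have cE : (p - s) * d - p * (d - t) = c0 by rewrite -E1 addKn.
have [|i [ri mi]] := witness (p - s) (d - t); last first.
  exists i; rewrite ri mi /col cE -E1.
  by have /eqP -> := leq_addr c0 (p * (d - t)).
rewrite /row_index in_row_rangeE // cE; apply/andP; split.
  by apply/and3P; split; lia.
by apply/orP; right; rewrite [ltnRHS]mulnBl; lia.
Qed.

End IndexData.

Local Open Scope ring_scope.

(** * The matrix of Phi *)

Lemma map_pencil_mx (R S : comNzRingType) (phi : {rmorphism R -> S}) n d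
    (N r c : 'I_n -> nat) (a : 'I_d.+1 -> R) :
  map_mx phi (pencil_mx N r c a) = pencil_mx N r c (phi \o a).
Proof.
apply/matrixP => i j; rewrite !mxE -coef_map rmorphM !rmorphXn /= map_polyX rmorph_sum /=.
congr (nth 0 (polyseq (_ * _ ^+ _)) _).
by apply: eq_bigr => l _; rewrite map_polyZ map_polyXn.
Qed.

(** The determinant with indeterminate coefficients specialises to the nonzero one of
    [det_pencil_mx_special], hence is itself nonzero. *)
Lemma det_pencil_mx_generic (k : fieldType) n d (N r c : 'I_n -> nat) :
  injective c -> (forall i, (r i)%:R != 0 :> k) ->
  (forall i, N i = (r i * d + c i)%N \/
    [/\ (N i + c i = r i * d)%N, (0 < c i)%N & (2 * c i <= d)%N]) ->
  exists2 g : {mpoly k[d.+1]}, g != 0 &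
    forall a : 'I_d.+1 -> k, g.@[a] = \det (pencil_mx N r c a).
Proof.
move=> inj_c r0 NP; exists (\det (pencil_mx N r c (fun i => 'X_i : {mpoly k[d.+1]}))).
  have [a] := det_pencil_mx_special inj_c r0 NP; apply: contraNneq => g0.
  pose iota : {rmorphism k -> {poly {poly k}}} := polyC \o polyC.
  pose phi : {rmorphism {mpoly k[d.+1]} -> {poly {poly k}}} := mmap iota a.
  have := congr1 phi g0; rewrite rmorph0 -det_map_mx map_pencil_mx => phi_g.
  apply/eqP; apply: etrans phi_g.
  by congr (\det (pencil_mx _ _ _ _)); apply/funext => i /=; rewrite /phi mmapX mmap1U.
move=> a; rewrite -[LHS](det_map_mx (meval a)) map_pencil_mx.
by congr (\det (pencil_mx _ _ _ _)); apply/funext => i /=; rewrite mevalXU.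
Qed.

Section PhiDescription.
Context (p d : nat) (k : fieldType) (a : 'I_d.+1 -> k) (J : nat).
Context (proot : k -> k).
Context (charK : p \in [pchar k]).
Context (prootK : forall c, proot c ^+ p = c).
Context (J_range : (1 < J < p)%N).
Local Notation K := (function_field p a).
Local Notation y := (yK p a : K).
Local Notation E := (polyK p a).
Local Notation f := (f_poly a).

Definition Hbound (l e : nat) : nat := (((p * (e + 1 - l) - e) * d) %/ p ^ 2)%N.

Lemma yK_polyK_inj1 n (P P' : {poly k}) : (n < p)%N ->
  y ^+ n * E P = y ^+ n * E P' -> P = P'.
Proof.
move=> np; have sumE (Q : {poly k}) : y ^+ n * E Q =
    \sum_(j < n.+1) y ^+ j * E (if (j < n)%N then 0 else Q).
  rewrite big_ord_recr /= ltnn big1 ?add0r // => i _.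
  by rewrite ltn_ord rmorph0 mulr0.
rewrite !sumE => /(yK_polyK_inj charK np)/(_ ord_max) /=.
by rewrite ltnn.
Qed.

Lemma HspaceP l e (v : K) : Hspace l e v <->
  exists2 P : {poly k}, (forall i, P`_i != 0 -> (i < Hbound l e)%N)
    & v = y ^+ l.-1 * E P.
Proof.
split=> [/kspan_omega[i /andP[]//|P PH ->]|[P PH ->]]; first by exists P.
by apply/kspan_omega; [move=> i /andP[] | exists P].
Qed.

Lemma Hspace_yK l e (P : {poly k}) : (l < p)%N ->
  Hspace l.+1 e (y ^+ l * E P) <-> (forall i, P`_i != 0 -> (i < Hbound l.+1 e)%N).
Proof.
move=> lp; split=> [/HspaceP[Q QH /(yK_polyK_inj1 lp) ->] //|PH].
by apply/HspaceP; exists P.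
Qed.

Lemma primeHP (v : K) : primeH J v <->
  exists2 P : {poly k}, (forall i, P`_i != 0 -> in_col_range p d J i.+1)
    & v = y ^+ J.-1 * E P.
Proof.
split=> [/kspan_omega[i []//|P PH ->]|[P PH ->]].
  by exists P => // i /PH[i0 ip ndvd]; apply/and3P.
apply/kspan_omega; first by move=> i [].
by exists P => // i /PH/and3P[].
Qed.

Lemma Hspace0 l e : Hspace l e (0 : K).
Proof. by apply/HspaceP; exists 0 => [i|]; rewrite ?coef0 ?eqxx // rmorph0 mulr0. Qed.

Lemma HspaceB l e (u v : K) : Hspace l e u -> Hspace l e v -> Hspace l e (u - v).
Proof.
move=> /HspaceP[P PH ->] /HspaceP[Q QH ->]; apply/HspaceP.
exists (P - Q); last by rewrite rmorphB mulrBr.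
move=> i; rewrite coefB; have [->|/PH //] := eqVneq P`_i 0.
by rewrite sub0r oppr_eq0 => /QH.
Qed.

(** The coefficient of y^l in C(y^(J-1) P dx), which belongs to the forms omega_(i,l+1); the power
    of f is r = J - 1 - l. *)
Definition cartier_coef (l : nat) (P : {poly k}) : {poly k} :=
  root_section p proot p.-1 (P * (- f) ^+ (J.-1 - l) *+ 'C(J.-1, l)).

Lemma coef_cartier_coef l P n : (cartier_coef l P)`_n =
  proot ((P * (- f) ^+ (J.-1 - l))`_(n * p + p.-1) *+ 'C(J.-1, l)).
Proof. by rewrite /cartier_coef (coef_root_section charK prootK) coefMn. Qed.

Lemma size_f_poly : (size f <= d.+1)%N.
Proof.
apply: leq_trans (size_sum _ _ _) _; apply/bigmax_leqP => i _.
by apply: leq_trans (size_scale_leq _ _) _; rewrite size_polyXn.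
Qed.

Section Column.
Context (P : {poly k}).
Context (P_col : forall i, P`_i != 0 -> in_col_range p d J i.+1).

(** A degree count: if x^i occurs, then p (i + 1) <= r d + [size P] with r = J - 1 - l. The top
    exponent of P makes [size P] an admissible column, so p times it is below (p - J) d. *)
Lemma cartier_coef_bound l i : (l < J.-1)%N ->
  (cartier_coef l P)`_i != 0 -> (i < Hbound l.+1 J)%N.
Proof.
move=> lJ; rewrite coef_cartier_coef => nz.
have p0 := p_gt1 charK.
have {}nz : (P * (- f) ^+ (J.-1 - l))`_(i * p + p.-1) != 0.
  by apply: contraNneq nz => ->; rewrite mul0rn (proot0 charK prootK).
have P0 : P != 0 by apply: contraNneq nz => ->; rewrite mul0r coef0.
have /and3P[_ sP _] : in_col_range p d J (size P).
  rewrite -(prednK (n := size P)) ?size_poly_gt0 //.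
  by apply: P_col; rewrite -lead_coefE lead_coef_eq0.
have lt_sz : (i * p + p.-1 < size (P * (- f) ^+ (J.-1 - l))%R)%N.
  by rewrite ltnNge; apply: contra nz => le; rewrite nth_default.
have sf : (size ((- f) ^+ (J.-1 - l))%R <= ((J.-1 - l) * d).+1)%N.
  apply: leq_trans (size_poly_exp_leq _ _) _; rewrite ltnS size_polyN mulnC.
  by rewrite leq_mul2l -[(size f).-1]subn1 leq_subLR add1n size_f_poly orbT.
have le_sz := size_polyMleq P ((- f) ^+ (J.-1 - l)).
rewrite /Hbound leq_divRL ?expn_gt0 ?(ltnW p0) //.
have -> : (J + 1 - l.+1 = (J.-1 - l) + 1)%N by lia.
have pJ : (J <= p)%N by lia.
have -> : (p * (J.-1 - l + 1) - J = p * (J.-1 - l) + (p - J))%N.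
  by rewrite mulnDr muln1 addnBA.
have lt1 : (i.+1 * p <= (J.-1 - l) * d + size P)%N.
  move: (leq_trans lt_sz le_sz) sf; set z := size P.
  by move: (size _) z => s z {lt_sz le_sz}; rewrite mulSn; lia.
apply: leq_trans (_ : (((J.-1 - l) * d + size P) * p <= _)%N).
  by rewrite -mulnn mulnA leq_mul2r lt1 orbT.
by rewrite !mulnDl -[(_ * d * p)%N]mulnC mulnA leq_add2l ltnW.
Qed.

Lemma components_cartier : components (cartier (y ^+ J.-1 * E P)) =
  (fun t : 'I_J.-1 => y ^+ t * E (cartier_coef t P)).
Proof.
have p0 := p_gt1 charK.
have -> : cartier (y ^+ J.-1 * E P) = \sum_(t < J.-1) y ^+ t * E (cartier_coef t P).
  (* The term in y^(J-1) vanishes: it reads P at the exponents np + p - 1, that is, at indices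
     divisible by p, which [primeH] excludes. *)
  rewrite (cartier_yK a charK prootK) big_ord_recr /= [X in _ + X](_ : _ = 0) ?addr0 //.
  rewrite -/(cartier_coef J.-1 P) [cartier_coef _ _](_ : _ = 0) ?rmorph0 ?mulr0 //.
  apply/polyP => n; rewrite coef0 coef_cartier_coef subnn expr0 mulr1.
  have [->|/P_col/and3P[_ _ /negP[]]] := eqVneq P`_(n * p + p.-1) 0.
    by rewrite mul0rn (proot0 charK prootK).
  by rewrite -addnS prednK ?dvdn_addl ?dvdn_mull //; lia.
have tp (t : 'I_J.-1) : (t < p)%N by have := ltn_ord t; lia.
apply: xget_unique.
  split=> // t; apply/(Hspace_yK _ _ (tp t)) => i.
  exact: cartier_coef_bound.
move=> u [uH uE]; apply/funext => t.
have /fin_all_exists[V VE] s : exists V : {poly k}, u s = y ^+ s * E V.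
  by have /HspaceP[V _ VE] := uH s; exists V.
have le_Jp : (J.-1 <= p)%N by lia.
rewrite /= (eq_bigr _ (fun s _ => VE s)) in uE.
rewrite VE; congr (_ * E _); apply/esym.
exact: (yK_polyK_inj charK le_Jp uE t).
Qed.

Lemma Phi_yK (t : 'I_J.-1) : @Phi p d k a J (y ^+ J.-1 * E P) t =
  Defs.coset (Hspace t.+1 J.-1) (y ^+ t * E (cartier_coef t P)).
Proof. by rewrite /Phi components_cartier. Qed.

End Column.

Lemma coset_yK (l e : nat) (V W : {poly k}) : (l < p)%N ->
  Defs.coset (Hspace l.+1 e) (y ^+ l * E V) = Defs.coset (Hspace l.+1 e) (y ^+ l * E W)
  <-> (forall i, (Hbound l.+1 e <= i)%N -> V`_i = W`_i).
Proof.
move=> lp; rewrite (coset_eqP _ _ (Hspace0 _ _) (@HspaceB _ _)) -mulrBr -rmorphB.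
rewrite Hspace_yK //; split=> VW i.
  rewrite leqNgt => lt; apply/eqP; rewrite -subr_eq0 -coefB.
  by apply: contraNT lt => /VW.
by rewrite coefB subr_eq0 => VWi; rewrite ltnNge; apply: contra VWi => /VW ->.
Qed.

End PhiDescription.

(** So the rows with r = J - 1 - t index the basis of the quotient H(t+1, J) / H(t+1, J-1). *)
Lemma Hbound_rowE p d J t m : (0 < p)%N -> (t < J.-1)%N ->
  in_row_range p d J (J.-1 - t) m =
  (Hbound p d t.+1 J.-1 < m <= Hbound p d t.+1 J)%N.
Proof.
move=> p0 tJ; rewrite /in_row_range /Hbound leq_divRL ?expn_gt0 ?p0 //.
rewrite ltn_divLR ?expn_gt0 ?p0 // (_ : J.-1 + 1 - t.+1 = J.-1 - t)%N; last lia.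
rewrite (_ : J + 1 - t.+1 = (J.-1 - t).+1)%N; last lia.
by rewrite (_ : (0 < J.-1 - t < J)%N) //; lia.
Qed.

(** * From an invertible minor to injectivity and surjectivity *)

Section MaximalRank.
Context (p d : nat) (k : fieldType) (a : 'I_d.+1 -> k) (J : nat).
Context (n : nat) (m r c : 'I_n -> nat) (proot : k -> k).
Context (charK : p \in [pchar k]).
Context (prootK : forall c, proot c ^+ p = c).
Context (J_range : (1 < J < p)%N).
Context (c_inj : injective c).
Context (c_range :
  forall i, in_col_range p d J (c i) && in_row_range p d J (r i) (m i)).
Local Notation M := (pencil_mx (fun i => m i * p)%N r c a).
Context (M_unit : \det M != 0).
Local Notation y := (yK p a).
Local Notation E := (polyK p a).
Local Notation f := (f_poly a).

Definition col_poly (b : 'cV[k]_n) : {poly k} := \sum_j b j 0 *: 'X^((c j).-1).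

Lemma coef_col_poly b (i : nat) : (col_poly b)`_i = \sum_(j | c j == i.+1) b j 0.
Proof.
rewrite coef_sum [RHS]big_mkcond; apply: eq_bigr => j _ /=.
have /andP[/and3P[c0 _ _] _] := c_range j.
rewrite coefZ coefXn -[c j in RHS]prednK // eqSS eq_sym.
by case: eqP; rewrite ?mulr1 ?mulr0.
Qed.

Lemma col_poly_range b i : (col_poly b)`_i != 0 -> in_col_range p d J i.+1.
Proof.
rewrite coef_col_poly; have [j /eqP <- _|none] := pickP (fun j => c j == i.+1).
  by have /andP[] := c_range j.
by rewrite big_pred0 ?eqxx.
Qed.

Lemma mulmx_col_poly b i : (M *m b) i 0 = ('X * col_poly b * f ^+ r i)`_(m i * p).
Proof.
rewrite mulr_sumr mulr_suml coef_sum mxE; apply: eq_bigr => j _.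
have /andP[/and3P[c0 _ _] _] := c_range j.
rewrite mxE -/f -scalerAr -exprS prednK // -scalerAl coefZ mulrC.
by [].
Qed.

(** The binomial coefficient divides (J - 1)!, which is prime to p because J - 1 < p. *)
Lemma bin_sign_neq0 t : (t < J.-1)%N -> (-1) ^+ (J.-1 - t) *+ 'C(J.-1, t) != 0 :> k.
Proof.
move=> tJ; rewrite -mulr_natr mulf_neq0 ?signr_eq0 // -(dvdn_pcharf charK).
have p_pr := pcharf_prime charK.
apply/negP => dv; have : (p %| (J.-1)`!)%N.
  by rewrite -(bin_fact (ltnW tJ)) dvdn_mulr.
rewrite fact_prod big_nat_cond; apply/negP; elim/big_ind: _ => [|u v|i].
- by rewrite dvdn1 gtn_eqF ?prime_gt1.
- by move=> pu pv; rewrite Euclid_dvdM // negb_or pu.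
by rewrite andbT => /andP[i0 iJ]; apply/negP => /dvdn_leq; lia.
Qed.

(** The factor x shifts the exponent ip + p - 1 to (i + 1) p, the form pm of the matrix rows with m
    = i + 1. *)
Lemma cartier_coefE t P (i : nat) : (t < J.-1)%N -> (cartier_coef p a J proot t P)`_i =
  proot (((-1) ^+ (J.-1 - t) *+ 'C(J.-1, t)) * ('X * P * f ^+ (J.-1 - t))`_(i.+1 * p)).
Proof.
move=> tJ; rewrite (coef_cartier_coef a J charK prootK) -scaleN1r exprZn -scalerAr coefZ.
have p0 := prime_gt0 (pcharf_prime charK).
rewrite -['X * P * _]mulrA coefXM muln_eq0 /= eqn0Ngt p0 /= mulrnAl.
by rewrite (_ : i.+1 * p = (i * p + p.-1).+1)%N //; lia.
Qed.

Let kappa i : k := (-1) ^+ (r i) *+ 'C(J.-1, J.-1 - r i).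

Let row_facts i : [/\ (J.-1 - r i < J.-1)%N, (J.-1 - (J.-1 - r i) = r i)%N,
  (0 < m i)%N &
  (Hbound p d (J.-1 - r i).+1 J.-1 <= (m i).-1 < Hbound p d (J.-1 - r i).+1 J)%N].
Proof.
have /andP[_ rm] := c_range i; have p0 := prime_gt0 (pcharf_prime charK).
have /andP[/andP[r0 rJ] _] := rm.
have tJ : (J.-1 - r i < J.-1)%N by lia.
have rE : (J.-1 - (J.-1 - r i) = r i)%N by lia.
have := Hbound_rowE d (m i) p0 tJ; rewrite rE rm => /esym /andP[lo up].
have m0 : (0 < m i)%N by apply: leq_ltn_trans lo.
by split=> //; rewrite -ltnS prednK // lo.
Qed.

Let cartier_coef_row P i : (cartier_coef p a J proot (J.-1 - r i) P)`_((m i).-1) =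
  proot (kappa i * ('X * P * f ^+ r i)`_(m i * p)).
Proof.
have [tJ rE m0 _] := row_facts i.
by rewrite cartier_coefE // rE prednK.
Qed.

Let kappa_neq0 i : kappa i != 0.
Proof. by have [tJ rE _ _] := row_facts i; have := bin_sign_neq0 tJ; rewrite rE. Qed.

Let M_unitmx : M \in unitmx.
Proof. by rewrite unitmxE unitfE. Qed.

(** As all admissible columns occur among the c_i, the difference of the two polynomials is
    [col_poly b] for some b. Equal cosets have equal coefficients in the selected rows, whence M b =
    0 and b = 0. *)
Lemma Phi_injective_of_minor :
  (forall c0, in_col_range p d J c0 -> exists i, c i = c0) -> Phi_injective p a J.
Proof.
move=> c_surj w w' /set_mem/primeHP[P PH ->] /set_mem/primeHP[P' PH' ->] eqPhi.
congr (_ * E _); apply/eqP; rewrite -subr_eq0.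
have [Q QB] : exists Q, Q = P - P' by exists (P - P').
rewrite -QB.
pose b : 'cV[k]_n := \col_j Q`_((c j).-1).
have QE : Q = col_poly b.
  apply/polyP => i; rewrite coef_col_poly.
  have [/c_surj[j cj]|ncol] := boolP (in_col_range p d J i.+1).
    rewrite (big_pred1 j) => [|j' /=]; last by rewrite -cj (inj_eq c_inj).
    by rewrite mxE cj.
  have Qi : Q`_i = 0.
    have -> : Q`_i = P`_i - P'`_i by rewrite QB coefB.
    have [->|/PH] := eqVneq P`_i 0; last by rewrite (negPf ncol).
    have [->|/PH'] := eqVneq P'`_i 0; last by rewrite (negPf ncol).
    exact: subrr.
  by rewrite big1 => [|j /eqP cj]; [exact: Qi | rewrite mxE cj /= Qi].
clearbody b; suff Mb0 : M *m b = 0.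
  have b0 : b = 0 by rewrite -(mulKmx M_unitmx b) Mb0 mulmx0.
  by rewrite QE b0 /col_poly big1 => [|j _]; [exact: eqxx | rewrite mxE scale0r].
apply/matrixP => i j; rewrite ord1 mulmx_col_poly -QE QB mxE.
have [tJ rE m0 /andP[lo up]] := row_facts i.
have eqt := congr1 (fun F => F (Ordinal tJ)) eqPhi; move: eqt => /= eqt.
have PhiP := Phi_yK a charK prootK J_range PH (Ordinal tJ).
have PhiP' := Phi_yK a charK prootK J_range PH' (Ordinal tJ).
have := etrans (esym PhiP) (etrans eqt PhiP'); rewrite /= => {eqt PhiP PhiP'}.
have tp : (J.-1 - r i < p)%N by lia.
move/(coset_yK a charK _ _ _ tp)/(_ _ lo); rewrite !cartier_coef_row => /(proot_inj prootK).
move/(mulfI (kappa_neq0 i))/eqP; rewrite -subr_eq0 -coefB -mulrBl -mulrBr.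
by move/eqP.
Qed.

Lemma Phi_surjective_of_minor :
  (forall r0 m0, in_row_range p d J r0 m0 -> exists i, r i = r0 /\ m i = m0) ->
  Phi_surjective p a J.
Proof.
move=> rm_surj q qH; have p0 := prime_gt0 (pcharf_prime charK).
have tp (t : 'I_J.-1) : (t < p)%N by have := ltn_ord t; lia.
have /fin_all_exists[V VP] (t : 'I_J.-1) : exists V : {poly k},
    (forall i, V`_i != 0 -> (i < Hbound p d t.+1 J)%N) /\
    q t = Defs.coset (Hspace t.+1 J.-1) (y ^+ t * E V).
  by have [v /HspaceP[V VH ->] <-] := qH t; exists V.
have tJ i : (J.-1 - r i < J.-1)%N by have [] := row_facts i.
(* The p-th power and the division by [kappa] undo the p-th root and the factor through which C
   differs from [M]. *)
pose z : 'cV[k]_n := \col_i ((V (Ordinal (tJ i)))`_((m i).-1) ^+ p / kappa i).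
pose P := col_poly (invmx M *m z).
have PH : forall i, P`_i != 0 -> in_col_range p d J i.+1 := @col_poly_range _.
exists (y ^+ J.-1 * E P); first by apply/primeHP; exists P.
apply/funext => t; rewrite (Phi_yK a charK prootK J_range) //; have [VH ->] := VP t.
apply/(coset_yK a charK _ _ _ (tp t)) => i lo.
(* Beyond the bound of H(t+1, J) both coefficients are 0; between the two bounds i + 1 is the m of a
   row, and every row is selected. *)
have [up|up] := ltnP i (Hbound p d t.+1 J); last first.
  rewrite [RHS](_ : _ = 0).
    apply: contraTeq up => nz.
    by rewrite -ltnNge (cartier_coef_bound charK prootK J_range PH (ltn_ord t) nz).
  by apply: contraTeq up => /VH; rewrite -ltnNge.
have [j [rj mj]] : exists j, r j = (J.-1 - t)%N /\ m j = i.+1.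
  by apply: rm_surj; rewrite Hbound_rowE // ltnS lo.
have tE : t = Ordinal (tJ j) by apply: val_inj; rewrite /= rj; have := ltn_ord t; lia.
have -> : i = (m j).-1 by rewrite mj.
rewrite {1}tE /= cartier_coef_row -mulmx_col_poly mulKVmx // mxE -tE.
by rewrite mulrC divfK // (exp_pchar_inj charK (prootK _)).
Qed.

End MaximalRank.

(** * The open set *)

Lemma generic_minor (p d : nat) (k : fieldType) (J : nat) :
  prime p -> odd p -> p \in [pchar k] -> perfect_field k -> ~~ (p %| d)%N ->
  (1 < J < p)%N ->
  exists2 g : {mpoly k[d.+1]}, g != 0 & forall a : 'I_d.+1 -> k, g.@[a] != 0 ->
    ((J <= (p + 1) %/ 2)%N -> Phi_surjective p a J) /\
    (((p + 1) %/ 2 <= J)%N -> Phi_injective p a J).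
Proof.
move=> p_pr p_odd charK k_perfect ndvd J_range.
have [proot prootK] := choice (k_perfect p charK).
have [n [m [r [c [c_inj c_range dich surj inj]]]]] := index_data p_pr p_odd ndvd J_range.
have r0 i : (r i)%:R != 0 :> k.
  rewrite -(dvdn_pcharf charK); have /andP[_ /andP[/andP[r0 rJ] _]] := c_range i.
  by apply/negP => /dvdn_leq; lia.
have [g g0 gE] := det_pencil_mx_generic c_inj r0 dich.
exists g => // a; rewrite gE => M0; split=> le_J.
  exact: (Phi_surjective_of_minor charK prootK J_range c_range M0 (surj le_J)).
exact: (Phi_injective_of_minor charK prootK J_range c_inj c_range M0 (inj le_J)).
Qed.

(** The generic point, with coordinates X_i in the fraction field, lies in D(g), since g takes the
    value g there. *)
Lemma open_nonempty_set1 (k : fieldType) n (g : {mpoly k[n]}) :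
  g != 0 -> open_nonempty [set g]%classic.
Proof.
move=> g0; pose L : fieldType := {fraction {mpoly k[n]}}.
pose iota : {rmorphism k -> L} := @tofrac {mpoly k[n]} \o @mpolyC n k.
exists L, iota, (fun i => tofrac 'X_i); exists g => //.
suff -> : mmap iota (fun i => tofrac 'X_i) g = tofrac g by rewrite tofrac_eq0.
rewrite [in RHS](mpolyE g) rmorph_sum; apply: eq_bigr => mu _ /=.
by rewrite -mul_mpolyC rmorphM /= mpolyXE_id rmorph_prod; congr (_ * _);
  apply: eq_bigr => i _; rewrite rmorphXn.
Qed.

Local Close Scope ring_scope.

Theorem theorem2p8 (p d : nat) (k : fieldType)
    (p_prime : prime p) (p_odd : odd p) (char_k : p \in [pchar k]%R)
    (k_perfect : perfect_field k) (d_gt0 : 0 < d) (p_ndvd_d : ~~ (p %| d)) :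
  exists U : zariski_open k d.+1,
    [/\ open_nonempty U,
        open_sub U (param_space k d)
      & forall a : 'I_d.+1 -> k, open_rational_points U a ->
          (forall J : nat, 1 < J <= (p + 1) %/ 2 -> Phi_surjective p a J) /\
          (forall J : nat, (p + 1) %/ 2 <= J < p -> Phi_injective p a J)].
Proof.
have p_gt2 : 2 < p by case: p p_prime p_odd {char_k p_ndvd_d} => [|[|[|]]].
have /fin_all_exists[g gP] (J : 'I_p) : exists g : {mpoly k[d.+1]}, g != 0%R /\
    (1 < J -> forall a : 'I_d.+1 -> k, g.@[a] != 0%R ->
      (J <= (p + 1) %/ 2 -> Phi_surjective p a J) /\
      ((p + 1) %/ 2 <= J -> Phi_injective p a J)).
  (* For J <= 1 the value 1 is padding, so that a single product runs over ['I_p]. *)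
  have [J1|J1] := ltnP 1 J; last by exists 1%R; rewrite oner_neq0.
  have J_range : 1 < J < p by rewrite J1 ltn_ord.
  have [g g0 gP] := generic_minor p_prime p_odd char_k k_perfect p_ndvd_d J_range.
  by exists g.
(* The first factor keeps U inside A; the product serves all J at once. *)
pose G : {mpoly k[d.+1]} := ('X_ord_max * \prod_J g J)%R.
have G0 : G != 0%R.
  rewrite mulf_neq0 //; last by apply/prodf_neq0 => J _; case: (gP J).
  apply/eqP => /(congr1 (mcoeff U_(ord_max))) /eqP.
  by rewrite mcoeffX eqxx mcoeff0 oner_eq0.
exists [set G]%classic; split; first exact: open_nonempty_set1.
  move=> L iota v [_ -> Gv]; exists 'X_ord_max%R => //.
  by apply: contraNneq Gv; rewrite rmorphM /= => ->; rewrite mul0r.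
move=> a [_ -> Ga].
have key J : 1 < J < p -> (J <= (p + 1) %/ 2 -> Phi_surjective p a J) /\
      ((p + 1) %/ 2 <= J -> Phi_injective p a J).
  move=> /andP[J1 Jp]; have [_ /(_ J1 a)] := gP (Ordinal Jp); apply.
  apply: contraNneq Ga => gJ; rewrite rmorphM /= rmorph_prod /=.
  by rewrite (bigD1 (Ordinal Jp)) //= gJ mul0r mulr0.
split=> J /andP[lo up].
  by have [|/(_ up)] := key J; first by rewrite lo; lia.
by have [|_ /(_ lo)] := key J; first by rewrite up andbT; lia.
Qed.
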